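(* For every positive integer $n$, $$\sum_{\ell(\lambda)\le n}\binom{n}{m_0(\lambda),m_1(\lambda),\dots}\prod_{i=1}^n q_i^{\lambda_i}=\frac{\sum_{\sigma\in B_n}\prod_{i=1}^n q_i^{2d_i(\sigma)+\varepsilon_i(\sigma)}}{\prod_{i=1}^n(1-q_1^2\cdots q_i^2)}$$ in $\mathbf{Z}[[q_1,\dots,q_n]]$, where the sum on the left is over all partitions $\lambda=(\lambda_1,\dots,\lambda_n)$ with at most $n$ nonzero parts.
   Context: For a partition $\lambda=(\lambda_1\ge\dots\ge\lambda_n\ge0)$, $m_j(\lambda)=|\{1\le i\le n:\lambda_i=j\}|$, and the coefficient is the multinomial coefficient. $B_n$ is the group of signed permutations of $[-n,n]\setminus\{0\}$. For $\sigma\in B_n$: ${\it Des}(\sigma)=\{i\in[n-1]:\sigma(i)>\sigma(i+1)\}$ (usual integer order), $d_i(\sigma)=|\{j\in{\it Des}(\sigma):j\ge i\}|$, $\varepsilon_i(\sigma)=1$ if $\sigma(i)<0$ and $0$ otherwise. *)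

(* Defs.v *)
From HB Require Import structures.
From mathcomp Require Import all_boot all_order all_algebra all_fingroup.
From mathcomp Require Import boolp classical_sets cardinality fsbigop.
From mathcomp Require Import mpoly.

Set Implicit Arguments.
Unset Strict Implicit.
Unset Printing Implicit Defensive.

Import GRing.Theory.
Local Open Scope ring_scope.

(* The ring R[[q_1, ..., q_n]] of formal power series: arbitrary coefficient  *)
(* functions on the monomials 'X_{1..n}, with the Cauchy product.             *)

Record mpseries (n : nat) (R : Type) : Type := MPSeries {
  mpscoef :> 'X_{1..n} -> R
}.

HB.instance Definition _ (n : nat) (R : Type) := gen_eqMixin (mpseries n R).
HB.instance Definition _ (n : nat) (R : Type) := gen_choiceMixin (mpseries n R).

Lemma mpsP (n : nat) (R : Type) (f g : mpseries n R) : f =1 g -> f = g.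
Proof. by case: f g => f [g] /= fg; congr MPSeries; apply/funext. Qed.

Section Ring.
Variables (n : nat) (R : comNzRingType).
Implicit Types (f g h : mpseries n R) (m : 'X_{1..n}) (k : nat).

Definition mps_zero : mpseries n R := MPSeries (fun=> 0).
Definition mps_opp f : mpseries n R := MPSeries (fun m => - f m).
Definition mps_add f g : mpseries n R := MPSeries (fun m => f m + g m).

Fact mps_addA : associative mps_add.
Proof. by move=> f g h; apply: mpsP => m /=; rewrite addrA. Qed.
Fact mps_addC : commutative mps_add.
Proof. by move=> f g; apply: mpsP => m /=; rewrite addrC. Qed.
Fact mps_add0 : left_id mps_zero mps_add.
Proof. by move=> f; apply: mpsP => m /=; rewrite add0r. Qed.
Fact mps_addN : left_inverse mps_zero mps_opp mps_add.
Proof. by move=> f; apply: mpsP => m /=; rewrite addNr. Qed.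

HB.instance Definition _ := GRing.isZmodule.Build (mpseries n R)
  mps_addA mps_addC mps_add0 mps_addN.

Lemma mps0E m : (0 : mpseries n R) m = 0. Proof. by []. Qed.
Lemma mpsDE f g m : (f + g) m = f m + g m. Proof. by []. Qed.
Lemma mpsNE f m : (- f) m = - f m. Proof. by []. Qed.
Lemma mps_sumE I (r : seq I) (P : pred I) (F : I -> mpseries n R) m :
  (\sum_(i <- r | P i) F i) m = \sum_(i <- r | P i) F i m.
Proof. exact: (big_morph (fun f : mpseries n R => f m)). Qed.

Definition mpsC (c : R) : mpseries n R :=
  MPSeries (fun m => if m == 0%MM then c else 0).
Definition mpsX (i : 'I_n) : mpseries n R :=
  MPSeries (fun m => (m == U_(i)%MM)%:R).

Definition mps_mul f g : mpseries n R := MPSeries (fun m =>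
  \sum_(k : 'X_{1..n < (mdeg m).+1, (mdeg m).+1} | m == (k.1 + k.2)%MM)
    f k.1 * g k.2).

Definition mps_trunc k f : {mpoly R[n]} :=
  \sum_(m : 'X_{1..n < k}) f m *: 'X_[m].

Lemma mps_truncE k f m : (mdeg m < k)%N -> (mps_trunc k f)@_m = f m.
Proof. exact: mcoeff_mpoly. Qed.

Lemma mps_mul_trunc k f g m : (mdeg m < k)%N ->
  mps_mul f g m = (mps_trunc k f * mps_trunc k g)@_m.
Proof.
move=> mk; rewrite (mcoeff_poly_mul _ _ (ltnSn _)) /=.
by apply: eq_bigr => -[a b] _ /=; rewrite !mps_truncE // (leq_trans (bmdeg _)).
Qed.

Lemma mcoeffM_eq k (p p' q q' : {mpoly R[n]}) :
    (forall m, (mdeg m < k)%N -> p@_m = p'@_m) ->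
    (forall m, (mdeg m < k)%N -> q@_m = q'@_m) ->
  forall m, (mdeg m < k)%N -> (p * q)@_m = (p' * q')@_m.
Proof.
move=> pp qq m mk; rewrite !(mcoeff_poly_mul _ _ (ltnSn _)).
by apply: eq_bigr => -[a b] _ /=;
   rewrite pp ?qq // (leq_trans (bmdeg _)).
Qed.

Fact mps_mulA : associative mps_mul.
Proof.
move=> f g h; apply: mpsP => m; pose k := (mdeg m).+1.
rewrite !(@mps_mul_trunc k) //.
have tr u v m' : (mdeg m' < k)%N ->
    (mps_trunc k (mps_mul u v))@_m' = (mps_trunc k u * mps_trunc k v)@_m'.
  by move=> m'k; rewrite mps_truncE // (mps_mul_trunc _ _ m'k).
by rewrite (mcoeffM_eq (fun _ _ => erefl) (tr _ _)) ?(mcoeffM_eq (tr _ _) (fun _ _ => erefl)) ?mulrA.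
Qed.

Fact mps_mulC : commutative mps_mul.
Proof.
move=> f g; apply: mpsP => m.
by rewrite !(@mps_mul_trunc (mdeg m).+1) // mulrC.
Qed.

Lemma mps_mulCE c f m : mps_mul (mpsC c) f m = c * f m.
Proof.
rewrite (@mps_mul_trunc (mdeg m).+1) //.
rewrite (@mcoeffM_eq (mdeg m).+1 _ c%:MP _ (mps_trunc (mdeg m).+1 f)) //.
  by rewrite mcoeffCM mps_truncE.
move=> m' m'k; rewrite mps_truncE // mcoeffC /=.
by case: eqP => _; rewrite ?mulr1 ?mulr0.
Qed.

Fact mps_mul1 : left_id (mpsC 1) mps_mul.
Proof. by move=> f; apply: mpsP => m; rewrite mps_mulCE mul1r. Qed.

Fact mps_mulD : left_distributive mps_mul mps_add.
Proof.
move=> f g h; apply: mpsP => m /=; rewrite -big_split /=.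
by apply: eq_bigr => k _; rewrite mulrDl.
Qed.

Fact mps_1_neq0 : mpsC 1 != 0.
Proof.
apply/eqP => /(congr1 (fun f : mpseries n R => f 0%MM)) /=.
by rewrite eqxx; apply/eqP/oner_neq0.
Qed.

HB.instance Definition _ := GRing.Zmodule_isComNzRing.Build (mpseries n R)
  mps_mulA mps_mulC mps_mul1 mps_mulD mps_1_neq0.

Lemma mps1E m : (1 : mpseries n R) m = (m == 0%MM)%:R.
Proof. by rewrite /GRing.one /=; case: eqP. Qed.

Lemma mpsME f g m : (f * g) m =
  \sum_(k : 'X_{1..n < (mdeg m).+1, (mdeg m).+1} | m == (k.1 + k.2)%MM)
    f k.1 * g k.2.
Proof. by []. Qed.

Lemma mpsCM c f m : (mpsC c * f) m = c * f m.
Proof. exact: mps_mulCE. Qed.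

Lemma mpsM_trunc k f g m : (mdeg m < k)%N ->
  (f * g) m = (mps_trunc k f * mps_trunc k g)@_m.
Proof. exact: mps_mul_trunc. Qed.

Lemma mpsM_eq k f f' g g' :
    (forall m, (mdeg m < k)%N -> f m = f' m) ->
    (forall m, (mdeg m < k)%N -> g m = g' m) ->
  forall m, (mdeg m < k)%N -> (f * g) m = (f' * g') m.
Proof.
move=> ff gg m mk; rewrite !mpsME.
by apply: eq_bigr => -[a b] _ /=; rewrite ff ?gg // (leq_trans (bmdeg _)).
Qed.

Lemma mpsM0 f g : (f * g) 0%MM = f 0%MM * g 0%MM.
Proof.
rewrite (@mpsM_eq (mdeg (0%MM : 'X_{1..n})).+1 _ (mpsC (f 0%MM)) _ g) ?mpsCM//.
by move=> m /=; rewrite mdeg0 ltnS leqn0 mdeg_eq0 => /eqP ->; rewrite eqxx.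
Qed.

Lemma mpsX_low f k m : f 0%MM = 0 -> (mdeg m < k)%N -> (f ^+ k) m = 0.
Proof.
move=> f0; elim: k m => // k IHk m mk; rewrite exprS mpsME.
apply: big1 => -[a b] /= /eqP mE.
have [bk|kb] := ltnP (mdeg b) k; first by rewrite IHk ?mulr0.
suff /eqP -> : bmnm a == 0%MM by rewrite f0 mul0r.
rewrite -mdeg_eq0 -leqn0 -(leq_add2r (mdeg b)) -mdegD -mE add0n.
exact: leq_trans kb.
Qed.

(* The sum of a possibly infinite family of series, taken coefficientwise.    *)
(* It is meaningful when the family is summable: each monomial occurs in only *)
(* finitely many terms; otherwise the fsbigop sums default to 0.              *)

Definition mps_summable (I : choiceType) (A : set I) (F : I -> mpseries n R) :=
  forall m, finite_set [set i | A i /\ F i m <> 0].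

Definition mps_fsum (I : choiceType) (A : set I) (F : I -> mpseries n R) :
  mpseries n R := MPSeries (fun m => \sum_(i \in A) F i m).

Lemma mpsXX (m : 'X_{1..n}) m' :
  (\prod_(i < n) mpsX i ^+ m i) m' = (m' == m)%:R.
Proof.
pose k := (mdeg m').+1.
suff H : forall m1, (mdeg m1 < k)%N ->
    (\prod_(i < n) mpsX i ^+ m i) m1 = ('X_[R, m])@_m1.
  by rewrite H // mcoeffX eq_sym.
have agreeM f g (p q : {mpoly R[n]}) :
    (forall m1, (mdeg m1 < k)%N -> f m1 = p@_m1) ->
    (forall m1, (mdeg m1 < k)%N -> g m1 = q@_m1) ->
    forall m1, (mdeg m1 < k)%N -> (f * g) m1 = (p * q)@_m1.
  move=> fp gq m1 m1k; rewrite (mpsM_trunc _ _ m1k).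
  by apply: mcoeffM_eq m1k => m2 m2k; rewrite mps_truncE ?fp ?gq.
have agree1 m1 : (mdeg m1 < k)%N -> (1 : mpseries n R) m1 = (1 : {mpoly R[n]})@_m1.
  by rewrite mps1E mcoeff1.
rewrite mpolyXE_id.
apply: (big_ind2 (fun (f : mpseries n R) (p : {mpoly R[n]}) =>
  forall m1, (mdeg m1 < k)%N -> f m1 = p@_m1)) => //.
  by move=> f p g q; exact: agreeM.
move=> i _; elim: (m i) => [|e IHe]; first by rewrite !expr0.
rewrite !exprS; apply: agreeM => // m1 _ /=.
by rewrite mcoeffX eq_sym.
Qed.

End Ring.

Section UnitRing.
Variables (n : nat) (R : comUnitRingType).
Implicit Types (f g : mpseries n R) (m : 'X_{1..n}).

(* A series is invertible iff its constant coefficient u is. The inverse is   *)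
(* then the geometric series u^-1 * \sum_k (1 - u^-1 f)^k, of which only the  *)
(* terms k <= mdeg m contribute to the coefficient of 'X_[m].                 *)

Definition mps_unit : pred (mpseries n R) :=
  fun f => f 0%MM \is a GRing.unit.

Definition mps_geo f k : mpseries n R :=
  mpsC n (f 0%MM)^-1 * \sum_(j < k) (1 - mpsC n (f 0%MM)^-1 * f) ^+ j.

Definition mps_inv f : mpseries n R :=
  if mps_unit f then MPSeries (fun m => mps_geo f (mdeg m).+1 m) else f.

Fact mps_mulVr : {in mps_unit, left_inverse 1 mps_inv *%R}.
Proof.
move=> f uf; apply: mpsP => m; rewrite /mps_inv (uf : mps_unit f).
pose d := (mdeg m).+1; set g := MPSeries _.
set u := (f 0%MM)^-1; set h := 1 - mpsC n u * f.
have h0 : h 0%MM = 0.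
  by rewrite mpsDE mpsNE mps1E eqxx mpsCM /u mulVr ?subrr.
rewrite (@mpsM_eq _ _ d g (mps_geo f d) f f) //; last first.
  move=> m' m'd; change (g m') with (mps_geo f (mdeg m').+1 m').
  rewrite /mps_geo -/u -/h !mpsCM !mps_sumE; congr (_ * _).
  rewrite -(subnKC m'd) big_split_ord /= [X in _ + X]big1 ?addr0 // => j _.
  by apply: mpsX_low => //; rewrite ltnS leq_addr.
rewrite /mps_geo -/u -/h mulrAC.
have -> : mpsC n u * f = 1 - h by rewrite /h opprB addrC subrK.
rewrite -opprB mulNr -subrX1 opprB mpsDE mpsNE mpsX_low ?subr0 //.
Qed.

Fact mps_unitPl f g : g * f = 1 -> mps_unit f.
Proof.
move=> /(congr1 (fun f : mpseries n R => f 0%MM)); rewrite mpsM0 mps1E eqxx.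
by move=> gf; apply/unitrPr; exists (g 0%MM); rewrite mulrC.
Qed.

Fact mps_inv_out : {in [predC mps_unit], mps_inv =1 id}.
Proof. by move=> f; rewrite inE => /negPf nf; rewrite /mps_inv [mps_unit f]nf. Qed.

HB.instance Definition _ := GRing.ComNzRing_hasMulInverse.Build (mpseries n R)
  mps_mulVr mps_unitPl mps_inv_out.

Lemma mps_unitE f : (f \is a GRing.unit) = (f 0%MM \is a GRing.unit).
Proof. by []. Qed.

End UnitRing.

(* Partitions with at most n nonzero parts, padded with zeros to length n. *)

Definition partitions (n : nat) : set (n.-tuple nat) :=
  [set lam : n.-tuple nat | sorted geq lam]%classic.
Arguments partitions n : clear implicits.

Definition mult (j : nat) (lam : seq nat) : nat := count_mem j lam.

Definition multinomial (n : nat) (s : seq nat) : nat :=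
  (n`! %/ \prod_(k <- s) k`!)%N.

(* The multiplicities m_0, m_1, ..., up to the largest part; the remaining    *)
(* ones are 0 and do not affect the multinomial coefficient.                  *)
Definition mults (lam : seq nat) : seq nat :=
  [seq mult j lam | j <- iota 0 (\max_(p <- lam) p).+1].

(* Signed permutations: B n is the group of the permutations s of the set     *)
(* [-n, n] \ {0} such that s (- x) = - s x.                                   *)

Definition srange (n : nat) : seq int :=
  [seq - (i%:Z) | i <- iota 1 n] ++ [seq i%:Z | i <- iota 1 n].

Definition sint (n : nat) : finType := seq_sub (srange n).

Lemma mem_srange (n : nat) (x : int) :
  (x \in srange n) = (x != 0) && (`|x| <= n)%N.
Proof.
rewrite mem_cat; apply/orP/andP => [[]|[x0 xn]].
- by move=> /mapP[i]; rewrite mem_iota => /andP[i0 ilt] ->;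
     rewrite oppr_eq0 abszN /=; split; [case: i i0 {ilt} | rewrite -ltnS].
- by move=> /mapP[i]; rewrite mem_iota => /andP[i0 ilt] ->; split;
     [case: i i0 {ilt} | rewrite -ltnS].
case: x x0 xn => i x0 xn; [right|left]; apply/mapP.
  by exists i => //; rewrite mem_iota add1n ltnS xn andbT lt0n.
by exists i.+1; rewrite ?NegzE // mem_iota add1n ltnS.
Qed.

Fact sopp_subproof (n : nat) (x : sint n) : - val x \in srange n.
Proof. by have := valP x; rewrite /= !mem_srange oppr_eq0 abszN. Qed.
Definition sopp (n : nat) (x : sint n) : sint n := SeqSub (sopp_subproof x).

Definition B (n : nat) : {set {perm sint n}} :=
  [set s : {perm sint n} | [forall x, s (sopp x) == sopp (s x)]].

Fact B_group_set (n : nat) : group_set (B n).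
Proof.
apply/group_setP; split; first by rewrite inE; apply/forallP => x; rewrite !perm1.
move=> s t; rewrite !inE => /forallP sP /forallP tP; apply/forallP => x.
by rewrite !permM (eqP (sP x)) (eqP (tP _)).
Qed.
Canonical B_group (n : nat) : {group {perm sint n}} := Group (B_group_set n).

(* An element i : 'I_n stands for the index i + 1 of [n]. *)

Fact spos_subproof (n : nat) (i : 'I_n) : i.+1%:Z \in srange n.
Proof. by rewrite mem_srange /= ltn_ord. Qed.
Definition spos (n : nat) (i : 'I_n) : sint n := SeqSub (spos_subproof i).

Section Statistics.
Variables (n : nat) (s : {perm sint n}).

Definition sval_at (i : 'I_n) : int := val (s (spos i)).

Definition Des : {set 'I_n} :=
  [set i : 'I_n |
    [exists j : 'I_n, (j == i.+1 :> nat) && (sval_at j < sval_at i)%R]].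

Definition d_stat (i : 'I_n) : nat := #|[set j in Des | (i <= j)%N]|.

Definition eps_stat (i : 'I_n) : nat := (sval_at i < 0)%R.

End Statistics.

(* The variable q_(i + 1) of Z[[q_1, ..., q_n]]. *)
Definition q (n : nat) (i : 'I_n) : mpseries n int := mpsX int i.

Lemma partition_terms_summable (n : nat) :
  mps_summable (partitions n) (fun lam : n.-tuple nat =>
    (multinomial n (mults lam))%:R * \prod_(i < n) q i ^+ tnth lam i).
Proof.
move=> m; apply: (@sub_finite_set _ _ [set multinom_val m]%classic).
  move=> lam [_ ]; set c := multinomial n _; set f : mpseries n int := \prod_(i < n) _.
  have -> : (c%:R * f) m = c%:R * (m == Multinom lam)%:R.
    rewrite -mpsXX -/f !mulr_natl; elim: c => [|k IHk].
      by rewrite !mulr0n.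
    by rewrite !mulrSr mpsDE IHk.
  by case: eqP => [-> //|_]; rewrite mulr0.
exact: finite_set1.
Qed.

Lemma denominator_unit (n : nat) :
  \prod_(i < n) (1 - \prod_(j < n | (j <= i)%N) q j ^+ 2) \is a GRing.unit.
Proof.
apply: rpred_prod => i _; rewrite mps_unitE mpsDE mpsNE mps1E eqxx.
suff -> : (\prod_(j < n | (j <= i)%N) q j ^+ 2) 0%MM = 0 by rewrite subr0.
rewrite (bigD1 i) ?leqnn // mpsM0 expr2 mpsM0.
have -> : q i 0%MM = 0.
  by rewrite /= eq_sym -mdeg_eq0 mdeg1.
by rewrite !mul0r.
Qed.

(* Main.v *)
(* The inverse of the denominator is the sum of the monomials with even
   nonincreasing exponents, so the coefficient of q^m on the right counts the s
   in B_n such that m - (2 d(s) + eps(s)) is nonnegative, even and nonincreasing.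
   This holds iff m is a partition, s(i) < 0 exactly when m_i is odd, and s
   increases on every block of equal entries of m. Such s correspond to the
   rearrangements f of m through f(|s(i)|) = m_i: s is recovered from f by
   sorting the positions by decreasing value of f, and then by increasing
   signed value. There are multinomial(n; m_0, m_1, ...) rearrangements. *)

Require Import Defs.
From HB Require Import structures.
From mathcomp Require Import all_boot all_order all_algebra all_fingroup.
From mathcomp Require Import boolp classical_sets cardinality fsbigop.
From mathcomp Require Import mpoly zify.
Import Order.Theory GRing.Theory Num.Theory.
Local Open Scope ring_scope.

(** * Multinomial coefficients and rearrangements of a list *)

Lemma sum_count_mem_undup (T : eqType) (s : seq T) :
  (\sum_(x <- undup s) count_mem x s = size s)%N.
Proof.
rewrite -sum1_size -[RHS]big_undup_iterop_count; apply: eq_bigr => x _.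
by rewrite Monoid.iteropE; elim: count => //= c <-.
Qed.

(** Induction on the length, by first letter: deleting [x] divides the product of factorials by
    [count_mem x s], and these counts sum to [size s] over the distinct letters. *)
Lemma size_permutations_count (T : eqType) (s r : seq T) :
  uniq r -> {subset s <= r} ->
  (size (permutations s) * \prod_(x <- r) (count_mem x s)`! = (size s)`!)%N.
Proof.
move=> Ur; move En: (size s) => k; elim: k s En => [|k IHk] s En sr.
  by rewrite (size0nil En) big1.
have s0 : (0 < size s)%N by rewrite En.
rewrite (perm_size (permutationsE s0)) size_allpairs_dep sumnE big_map.
rewrite big_distrl /= factS -En -sum_count_mem_undup.
rewrite big_distrl /=; apply: eq_big_seq => x; rewrite mem_undup => xs.
have sx : size (rem x s) = k by rewrite size_rem // En.
rewrite -(IHk _ sx) => [|y /mem_rem /sr //].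
rewrite mulnCA; congr (_ * _)%N.
rewrite !(bigD1_seq x (sr _ xs) Ur) /= mulnA count_mem_rem eqxx subn1.
have : (0 < count_mem x s)%N by rewrite -has_count has_pred1.
case: (count_mem x s) => // c _; rewrite factS; congr (_ * _)%N.
by apply: eq_bigr => y; rewrite count_mem_rem eq_sym => /negPf ->; rewrite subn0.
Qed.

Lemma multinomial_mults (s : seq nat) :
  multinomial (size s) (mults s) = size (permutations s).
Proof.
rewrite /multinomial /mults big_map.
rewrite -(@size_permutations_count _ s (iota 0 (\max_(p <- s) p).+1)).
- by rewrite mulnK // prodn_gt0 // => j; rewrite fact_gt0.
- exact: iota_uniq.
by move=> x xs; rewrite mem_iota ltnS leq_bigmax_seq.
Qed.

(** * Expansion of the inverse denominator *)

Section Coefficients.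
Context {n : nat}.
Implicit Types (f : mpseries n int) (m w : 'X_{1..n}).

Lemma mps_natM c f m : (c%:R * f) m = c%:R * f m.
Proof.
rewrite !mulr_natl; elim: c => [|c IHc]; first by rewrite !mulr0n.
by rewrite !mulrSr mpsDE IHc.
Qed.

Lemma mps_monomM w f m :
  ((\prod_(i < n) mpsX int i ^+ w i) * f) m =
  if (w <= m)%MM then f (m - w)%MM else 0.
Proof.
pose k := (mdeg m).+1; have mk : (mdeg m < k)%N by [].
have -> : ((\prod_(i < n) mpsX int i ^+ w i) * f) m =
          (mps_trunc k f * 'X_[w])@_m.
  rewrite mulrC (mpsM_trunc _ _ mk).
  apply: mcoeffM_eq mk => // m' m'k.
  by rewrite mps_truncE // mpsXX mcoeffX eq_sym.
case: ifP => wm.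
  rewrite -{1}(submK wm) addmC mcoeffMX mps_truncE //.
  by rewrite (leq_ltn_trans _ mk) // -{2}(submK wm) mdegD leq_addr.
rewrite (mcoeff_poly_mul _ _ mk) big1 // => -[a b] /= /eqP mE.
rewrite mcoeffX; case: eqP => [wb|]; last by rewrite mulr0.
by rewrite mE -wb lem_addl in wm.
Qed.

Definition even_partition (k : nat) : pred 'X_{1..n} := fun m =>
  [&& [forall i : 'I_n, ~~ odd (m i)],
      [forall i : 'I_n, [forall j : 'I_n, (i <= j)%N ==> (m j <= m i)%N]] &
      [forall i : 'I_n, (k <= i)%N ==> (m i == 0%N)]].

(* The inverse of the product of the first [k] factors of the denominator:
   expanding it yields the conjugate partitions with parts at most [k]. *)
Definition even_partition_series (k : nat) : mpseries n int :=
  MPSeries (fun m => (even_partition k m)%:R).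

Lemma even_partitionP k m :
  reflect [/\ forall i, ~~ odd (m i),
              forall i j : 'I_n, (i <= j)%N -> (m j <= m i)%N &
              forall i : 'I_n, (k <= i)%N -> m i = 0%N]
          (even_partition k m).
Proof.
apply: (iffP and3P) => [[/forallP H1 /forallP H2 /forallP H3]|[H1 H2 H3]].
  split=> // [i j ij|i ki]; last by apply/eqP; move: (H3 i); rewrite ki.
  by move: (H2 i) => /forallP /(_ j); rewrite ij.
split; [exact/forallP| |]; apply/forallP => i.
  by apply/forallP => j; apply/implyP/H2.
by apply/implyP => /H3 ->.
Qed.

Lemma even_partition_series0 : even_partition_series 0 = 1.
Proof.
apply: mpsP => m; rewrite mps1E /=; congr (nat_of_bool _)%:R.
apply/even_partitionP/eqP => [[_ _ H]|->]; last by split=> *; rewrite !mnm0E.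
by apply/mnmP => i; rewrite mnm0E H.
Qed.

(** Adding 2 to the entries up to [i] maps the even partitions bijectively onto those with [m i]
    nonzero, so the subtracted shift leaves exactly those with [m i = 0]. *)
Lemma even_partition_seriesS (i : 'I_n) :
  even_partition_series i.+1 * (1 - \prod_(j < n | (j <= i)%N) q j ^+ 2) =
  even_partition_series i.
Proof.
pose w : 'X_{1..n} := [multinom (if (j <= i)%N then 2 else 0)%N | j < n].
have -> : \prod_(j < n | (j <= i)%N) q j ^+ 2 =
          \prod_(j < n) mpsX int j ^+ w j.
  rewrite big_mkcond /=; apply: eq_bigr => j _.
  by rewrite mnmE; case: ifP.
apply: mpsP => m; rewrite mulrBr mulr1 mulrC mpsDE mpsNE mps_monomM /=.
have -> : (if (w <= m)%MM then (even_partition i.+1 (m - w)%MM)%:R else 0 : int) =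
   ((even_partition i.+1 m) && (m i != 0%N))%:R.
  set b := _ && _.
  suff -> : b = (w <= m)%MM && even_partition i.+1 (m - w)%MM by case: ifP.
  apply/andP/andP => -[].
    move=> /even_partitionP[H1 H2 H3] mi.
    have wm : (w <= m)%MM.
      apply/mnm_lepP => j; rewrite mnmE; case: ifP => // ji.
      (* A nonzero even [m i] is at least 2, hence so is every earlier entry. *)
      by have := H1 i; have := H2 _ _ ji; lia.
    split=> //; apply/even_partitionP; split=> [j|j k jk|j ij].
    + by move/mnm_lepP: wm => /(_ j); have := H1 j; rewrite mnmBE mnmE; case: (j <= i)%N; lia.
    + move/mnm_lepP: wm => wm; rewrite !mnmBE.
      have := H2 _ _ jk; move: (wm j) (wm k); rewrite !mnmE.
      have [ki|ik] := leqP k i; last by rewrite (H3 k ik) sub0n.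
      by rewrite (leq_trans jk ki) => *; rewrite leq_sub2r.
    + by rewrite mnmBE H3.
  move=> /mnm_lepP wm /even_partitionP[H1 H2 H3].
  have mE j : m j = ((m - w)%MM j + w j)%N by rewrite mnmBE subnK.
  split; last by have := wm i; rewrite mnmE leqnn; lia.
  apply/even_partitionP; split=> [j|j k jk|j ij].
  - by rewrite mE oddD (negPf (H1 j)) mnmE; case: ifP.
  - rewrite !mE leq_add ?H2 // !mnmE.
    by have [ki|//] := leqP k i; rewrite (leq_trans jk ki).
  - by rewrite mE H3 // add0n mnmE leqNgt ij.
suff -> : even_partition i m = even_partition i.+1 m && (m i == 0%N).
  by case: (even_partition i.+1 m); case: (m i == 0%N).
apply/even_partitionP/andP => [[H1 H2 H3]|[/even_partitionP[H1 H2 H3] /eqP mi]].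
  split; last by rewrite H3.
  by apply/even_partitionP; split=> // j ij; rewrite H3 // ltnW.
split=> // j; rewrite leq_eqVlt => /predU1P[ij|/H3 //].
by rewrite -(val_inj ij).
Qed.

Lemma even_partition_series_denominator :
  even_partition_series n *
    \prod_(i < n) (1 - \prod_(j < n | (j <= i)%N) q j ^+ 2) = 1.
Proof.
(* Generalised to [k] factors, which are cancelled from the last one down. *)
suff H k : (k <= n)%N -> even_partition_series k *
    \prod_(i < n | (i < k)%N) (1 - \prod_(j < n | (j <= i)%N) q j ^+ 2) = 1.
  rewrite -[RHS](H n) //; congr (_ * _); apply: eq_bigl => i.
  by rewrite ltn_ord.
elim: k => [|k IHk] kn; first by rewrite big_pred0 // mulr1 even_partition_series0.
rewrite (bigD1 (Ordinal kn)) //= mulrA (even_partition_seriesS (Ordinal kn)) /=.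
rewrite -[RHS](IHk (ltnW kn)); congr (_ * _); apply: eq_bigl => i.
by rewrite ltnS -val_eqE /= andbC -ltn_neqAle.
Qed.

End Coefficients.

(** * Monotone sequences, descents and exponents *)

Lemma ord_nonincreasing (n : nat) (f : 'I_n -> nat) :
  (forall i j : 'I_n, j = i.+1 :> nat -> (f j <= f i)%N) ->
  forall i j : 'I_n, (i <= j)%N -> (f j <= f i)%N.
Proof.
move=> fS i [j jn] /=; elim: j jn => [|j IHj] jn ij.
  by rewrite (_ : i = Ordinal jn) //; apply: val_inj => /=; lia.
move: ij; rewrite leq_eqVlt => /predU1P[ij|ij].
  by rewrite (_ : i = Ordinal jn) //; apply: val_inj.
by apply: leq_trans (IHj (ltnW jn) _); [apply: fS | rewrite -ltnS].
Qed.

Lemma sorted_codomP (n : nat) (T : Type) (r : rel T) (g : 'I_n -> T) :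
  reflect (forall i j : 'I_n, j = i.+1 :> nat -> r (g i) (g j))
          (sorted r (codom g)).
Proof.
rewrite codomE sorted_map; case: n g => [|n] g.
  by rewrite (size0nil (size_enum_ord 0)); constructor => -[].
apply: (iffP (sortedP ord0)) => [H i j ji|H i].
  by have := H i; rewrite size_enum_ord -ji ltn_ord !nth_ord_enum; apply.
rewrite size_enum_ord => iS.
have := H (Ordinal (ltnW iS)) (Ordinal iS) erefl.
by rewrite /= -(nth_ord_enum ord0 (Ordinal iS)) -(nth_ord_enum ord0 (Ordinal (ltnW iS))).
Qed.

Lemma sorted_geqP (n : nat) (m : 'X_{1..n}) :
  reflect (forall i j : 'I_n, j = i.+1 :> nat -> (m j <= m i)%N)
          (sorted geq (multinom_val m)).
Proof.
rewrite -{1}(map_tnth_enum (multinom_val m)) -codomE.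
exact: sorted_codomP.
Qed.

Section Statistics.
Context {n : nat}.
Implicit Types (m : 'X_{1..n}) (s : {perm sint n}) (i j : 'I_n).

Definition weight s : 'X_{1..n} :=
  [multinom (2 * d_stat s i + eps_stat s i)%N | i < n].

Lemma sval_at_inj s : injective (sval_at s).
Proof. by move=> i j /val_inj/perm_inj/(congr1 val)[] /val_inj. Qed.

Lemma d_stat_last s i : i.+1 = n -> d_stat s i = 0%N.
Proof.
move=> iS; apply: eq_card0 => j; rewrite !inE.
apply/negP => /andP[/existsP[k /andP[/eqP kj _]] ij].
by have := ltn_ord k; lia.
Qed.

Lemma d_stat_succ s i j : j = i.+1 :> nat ->
  d_stat s i = ((sval_at s j < sval_at s i)%R + d_stat s j)%N.
Proof.
move=> ji; rewrite /d_stat (cardsD1 i) !inE leqnn andbT; congr (_ + _)%N.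
  congr (nat_of_bool _); apply/existsP/idP => [[k /andP[/eqP ki]]|H].
    by rewrite (_ : k = j) //; apply: val_inj; rewrite /= ki.
  by exists j; rewrite ji eqxx.
apply: eq_card => k; rewrite !inE ji -val_eqE /= ltn_neqAle eq_sym.
by case: [exists _, _]; rewrite ?andbF ?andbT.
Qed.

(** Neighbours suffice in the second clause: equal entries of a sorted [m] are contiguous. *)
Definition compatible m s : bool :=
  [forall i, eps_stat s i == odd (m i)] &&
  [forall i : 'I_n, [forall j : 'I_n, (j == i.+1 :> nat) && (m i == m j) ==>
                        (sval_at s i < sval_at s j)%R]].

Lemma compatibleP m s :
  reflect ((forall i, (sval_at s i < 0)%R = odd (m i)) /\
           (forall i j, j = i.+1 :> nat -> m i = m j ->
                        (sval_at s i < sval_at s j)%R))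
          (compatible m s).
Proof.
apply: (iffP andP) => -[H1 H2]; split.
- by move=> i; move/forallP: H1 => /(_ i); rewrite /eps_stat; case: (_ < _)%R; case: odd.
- move=> i j ji mij; move/forallP: H2 => /(_ i) /forallP /(_ j).
  by rewrite ji mij !eqxx.
- by apply/forallP => i; rewrite /eps_stat H1.
apply/forallP => i; apply/forallP => j; apply/implyP => /andP[/eqP ji /eqP].
exact: H2.
Qed.

(* Writing e_i for the parity of m_i, descents of [s] force m_i > m_(i + 1), and
   conversely e_i = 0, e_(i + 1) = 1 forces a descent; so m - weight s is
   nonincreasing exactly when m is and [s] has no descent inside a block. *)
Lemma weight_even_partition m s :
  ((weight s <= m)%MM && even_partition n (m - weight s)%MM) =
  (sorted geq (multinom_val m) && compatible m s).
Proof.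
have weightE i : weight s i = (2 * d_stat s i + (sval_at s i < 0)%R)%N.
  by rewrite mnmE.
apply/andP/andP => [[/mnm_lepP wm /even_partitionP[H1 H2 _]]|].
  have mE i : m i = ((m - weight s)%MM i + weight s i)%N by rewrite mnmBE subnK.
  have par i : (sval_at s i < 0)%R = odd (m i).
    by rewrite mE weightE oddD (negPf (H1 i)) oddD oddM oddb.
  split.
    apply/sorted_geqP => i j ji; have := H2 i j; rewrite ji leqnSn => /(_ isT).
    by rewrite !mE !weightE (d_stat_succ _ _ _ ji); lia.
  apply/compatibleP; split=> // i j ji mij.
  have aDb : sval_at s i != sval_at s j.
    by apply/eqP => /sval_at_inj ij; move: ji; rewrite ij; lia.
  have := H2 i j; rewrite ji leqnSn => /(_ isT).
  (* Equal entries give equal signs, so a descent at [i] would make the weight drop by 2 while [m]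
     stays constant. *)
  have := par i; rewrite mij -par => sij.
  by move: mij; rewrite !mE !weightE (d_stat_succ _ _ _ ji); lia.
move=> [/sorted_geqP sm /compatibleP[par H]].
(* If [m i = m j], the weights agree. Otherwise they drop by at most 2, and by 2 only when the signs
   agree; then [m] drops by a positive even number. *)
have step i j : j = i.+1 :> nat -> (m j + weight s i <= m i + weight s j)%N.
  move=> ji; have := sm _ _ ji; have := H _ _ ji; have := par i; have := par j.
  by rewrite !weightE (d_stat_succ _ _ _ ji); lia.
have wm : (weight s <= m)%MM.
  (* Induction from the last index down: there the weight is just the parity of [m], and [step]
     carries the bound backwards. *)
  apply/mnm_lepP => i; have [k] := ubnP (n - i); elim: k i => // k IHk i ik.
  have [iS|iS] := ltnP i.+1 n.
    have := step i (Ordinal iS) erefl; have := IHk (Ordinal iS).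
    by rewrite /=; lia.
  have iE : i.+1 = n by have := ltn_ord i; lia.
  by rewrite weightE d_stat_last // par; case: (m i) => // k'; case: odd.
split=> //; apply/even_partitionP; split=> [i||i].
- rewrite mnmBE oddB; last exact: (mnm_lepP wm).
  by rewrite weightE par oddD oddM oddb addbb.
- apply: ord_nonincreasing => i j ji; rewrite !mnmBE.
  by have := step _ _ ji; move: (mnm_lepP wm i) (mnm_lepP wm j); lia.
- by rewrite leqNgt ltn_ord.
Qed.

End Statistics.

(** * Signed permutations as pairs of signs and a permutation *)

Section SignedPermutations.
Context {n : nat}.
Implicit Types (x y : sint n) (i j a : 'I_n) (b : bool) (e : 'I_n -> bool).
Implicit Types (p : 'S_n) (s : {perm sint n}).

Fact signed_subproof b i : (if b then - i.+1%:Z else i.+1%:Z) \in srange n.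
Proof. by rewrite mem_srange; case: b; rewrite ?abszN /= ltn_ord. Qed.
Definition signed b i : sint n := SeqSub (signed_subproof b i).

Fact sabs_subproof x : (`|val x|.-1 < n)%N.
Proof. by have := valP x; rewrite /= mem_srange; lia. Qed.
Definition sabs x : 'I_n := Ordinal (sabs_subproof x).

Definition sneg x : bool := (val x < 0)%R.

Lemma sabs_signed b i : sabs (signed b i) = i.
Proof. by apply: val_inj => /=; case: b; rewrite ?abszN. Qed.

Lemma sneg_signed b i : sneg (signed b i) = b.
Proof. by rewrite /sneg /=; case: b; lia. Qed.

Lemma signed_sneg_sabs x : signed (sneg x) (sabs x) = x.
Proof.
apply: val_inj; have := valP x; rewrite /sneg /= mem_srange.
by case: ifP; lia.
Qed.

Lemma spos_signed i : spos i = signed false i.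
Proof. exact: val_inj. Qed.

Lemma sopp_signed b i : sopp (signed b i) = signed (~~ b) i.
Proof. by apply: val_inj => /=; case: b; rewrite //= opprK. Qed.

Lemma signed_perm_subproof e p :
  injective (fun x => signed (sneg x (+) e (sabs x)) (p (sabs x))).
Proof.
move=> x y xy; rewrite -[x]signed_sneg_sabs -[y]signed_sneg_sabs.
have := congr1 sabs xy; rewrite !sabs_signed => /perm_inj xyE.
by move: (congr1 sneg xy); rewrite !sneg_signed xyE => /addIb ->.
Qed.
(* [signed_perm e p] is the element of [B n] sending [i + 1] to [p i + 1], with
   a minus sign when [e i]. *)
Definition signed_perm e p : {perm sint n} := perm (signed_perm_subproof e p).

Lemma signed_permE e p b i : signed_perm e p (signed b i) = signed (b (+) e i) (p i).
Proof. by rewrite permE sneg_signed sabs_signed. Qed.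

Lemma sval_at_signed_perm e p i : sval_at (signed_perm e p) i = val (signed (e i) (p i)).
Proof. by rewrite /sval_at spos_signed signed_permE. Qed.

Lemma signed_perm_inj e : injective (signed_perm e).
Proof.
move=> p p' pp'; apply/permP => i.
have := congr1 (fun s : {perm sint n} => sabs (s (signed false i))) pp'.
by rewrite !signed_permE !sabs_signed.
Qed.

Lemma signed_permP s :
  reflect (exists p, s = signed_perm (fun i => sneg (s (spos i))) p) (s \in B n).
Proof.
rewrite inE; apply: (iffP forallP) => [sB|[p ->] x]; last first.
  rewrite -[x]signed_sneg_sabs sopp_signed !signed_permE sopp_signed.
  by rewrite addNb.
have sN b i : s (signed b i) = signed (b (+) sneg (s (spos i))) (sabs (s (spos i))).
  rewrite spos_signed; case: b; last by rewrite signed_sneg_sabs.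
  have /eqP := sB (signed false i); rewrite sopp_signed /= => ->.
  by rewrite -{1}[s _]signed_sneg_sabs sopp_signed.
(* If the images of [i] and [j] have the same absolute value, oddness makes [s] agree at [i] and at
   [j] up to sign, so injectivity of [s] applies. *)
have inj_p : injective (fun i => sabs (s (spos i))).
  move=> i j /= ij.
  have := sN (sneg (s (spos i)) (+) sneg (s (spos j))) j.
  rewrite -addbA addbb addbF -ij signed_sneg_sabs => /perm_inj /(congr1 sabs).
  by rewrite spos_signed !sabs_signed.
exists (perm inj_p); apply/permP => x.
by rewrite -[x]signed_sneg_sabs signed_permE permE sN.
Qed.

End SignedPermutations.

(** * Compatible signed permutations and rearrangements *)

Section Counting.
Context {n : nat}.
Implicit Types (t u : n.-tuple nat) (p : 'S_n) (i j a b c : 'I_n).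

(** With [t] indexed by absolute values, this is the value of absolute value [a + 1] taken by the
    signed permutation, its sign fixed by parity. *)
Definition signed_value t a : int := val (signed (odd (tnth t a)) a).

(* Sorting the positions by this order inverts [rearrange]: decreasing entries,
   and within a block of equal entries increasing signed values. *)
Definition block_le t : rel 'I_n := fun a b =>
  (tnth t b < tnth t a)%N ||
  (tnth t a == tnth t b) && (signed_value t a <= signed_value t b)%R.

Lemma signed_value_inj t : injective (signed_value t).
Proof. by move=> a b /val_inj /(congr1 sabs); rewrite !sabs_signed. Qed.

Lemma block_le_total t : total (block_le t).
Proof. by move=> a b; rewrite /block_le; case: ltngtP => //= _; case: lerP => // /ltW. Qed.

Lemma block_le_trans t : transitive (block_le t).
Proof. by move=> a b c; rewrite /block_le; lia. Qed.

Lemma block_le_anti t : antisymmetric (block_le t).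
Proof. by move=> a b H; apply: (@signed_value_inj t); move: H; rewrite /block_le; lia. Qed.

Definition block_increasing t p : bool :=
  [forall i : 'I_n, [forall j : 'I_n, (j == i.+1 :> nat) && (tnth t i == tnth t j) ==>
    (val (signed (odd (tnth t i)) (p i)) < val (signed (odd (tnth t j)) (p j)))%R]].

(** The entry at [i] moves to position [p i], hence the inverse. *)
Definition rearrange t p : n.-tuple nat := [tuple tnth t ((p^-1)%g a) | a < n].

Lemma tnth_rearrange t p i : tnth (rearrange t p) (p i) = tnth t i.
Proof. by rewrite tnth_mktuple permK. Qed.

Lemma perm_rearrange t p : perm_eq (rearrange t p) t.
Proof. by apply/tuple_permP; exists (p^-1)%g. Qed.

Lemma block_increasingE t p : sorted geq t ->
  block_increasing t p = sorted (block_le (rearrange t p)) (codom p).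
Proof.
rewrite -{1}(map_tnth_enum t) -codomE => /sorted_codomP st.
apply/forallP/sorted_codomP => H i => [j ji|].
  have := H i => /forallP/(_ j); have := st _ _ ji.
  rewrite /block_le /signed_value !tnth_rearrange ji eqxx /=.
  by case: ltngtP => //= _ _; apply: ltW.
apply/forallP => j; apply/implyP => /andP[/eqP ji /eqP tij].
have := H _ _ ji; rewrite /block_le !tnth_rearrange tij ltnn eqxx /= => le_v.
(* [block_le] is only weak; strictness holds because equal values with a common sign would force
   [p i = p j]. *)
rewrite lt_neqAle; move: le_v; rewrite /signed_value !tnth_rearrange tij => ->.
rewrite andbT; apply/eqP => pij.
have /val_inj/perm_inj ij : val (p i) = val (p j) by move: pij => /=; case: odd; lia.
by move: ji; rewrite ij; lia.
Qed.

Lemma perm_codom p : perm_eq (codom p) (enum 'I_n).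
Proof.
apply: uniq_perm; rewrite ?enum_uniq //; first by apply/injectiveP/perm_inj.
by move=> i; rewrite mem_enum -[i in LHS](permKV p) codom_f.
Qed.

Lemma card_block_increasing t : sorted geq t ->
  #|[set p : 'S_n | block_increasing t p]| = size (permutations t).
Proof.
move=> st; rewrite cardE -(size_map (fun p => tval (rearrange t p))).
apply: perm_size; apply: uniq_perm; rewrite ?permutations_uniq //.
  rewrite map_inj_in_uniq ?enum_uniq // => p p'.
  rewrite !mem_enum !inE !block_increasingE // => sp sp' /val_inj pp'.
  rewrite -pp' in sp'.
  (* Both lists enumerate all positions in increasing order for one antisymmetric relation. *)
  have cpp' : codom p = codom p'.
    apply: (sorted_eq (@block_le_trans _) (@block_le_anti _) sp sp').
    by rewrite (perm_trans (perm_codom p)) // perm_sym perm_codom.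
  move: cpp'; rewrite !codomE => /eq_in_map H.
  by apply/permP => i; rewrite H ?mem_enum.
move=> u; rewrite mem_permutations; apply/mapP/idP => [[p _ ->]|ut].
  exact: perm_rearrange.
have su : size u == n by rewrite (perm_size ut) size_tuple.
pose f : n.-tuple nat := Tuple su.
(* The preimage of [u] lists the positions in [block_le] order. *)
pose l := sort (block_le f) (enum 'I_n).
have sl : size l == n by rewrite size_sort size_enum_ord.
have /tuple_permP[p lE] : perm_eq (Tuple sl) (ord_tuple n) by rewrite perm_sort.
have {}lE : l = codom p.
  rewrite [LHS]lE codomE; apply: eq_map => i /=; by rewrite tnth_ord_tuple.
have sp : sorted (block_le f) (codom p) by rewrite -lE sort_sorted //; apply: block_le_total.
(* Read in this order, the entries of [f] decrease weakly, and [t] is their only such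
   arrangement. *)
have fp : map (tnth f) (codom p) = t.
  apply: (@sorted_eq _ geq).
  - by move=> a b c; lia.
  - by move=> a b; lia.
  - rewrite sorted_map; apply: sub_sorted sp => a b; rewrite /block_le /=; lia.
  - exact: st.
  by rewrite (perm_trans (perm_map _ (perm_codom p))) // map_tnth_enum.
have rf : rearrange t p = f.
  apply: eq_from_tnth => a; rewrite -[a](permKV p) tnth_rearrange.
  rewrite (tnth_nth 0%N) -fp codomE -map_comp.
  by rewrite (nth_map ((p^-1)%g a)) ?size_enum_ord // nth_ord_enum.
by exists p; rewrite ?rf // mem_enum inE block_increasingE // rf.
Qed.

Lemma card_compatible (m : 'X_{1..n}) : sorted geq (multinom_val m) ->
  #|[set s in B n | compatible m s]| = multinomial n (mults (multinom_val m)).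
Proof.
move=> sm; have := multinomial_mults (multinom_val m).
rewrite size_tuple => ->; rewrite -card_block_increasing //.
(* Parities of [m] prescribe the signs, leaving only the permutation to count. *)
rewrite -(card_imset _ (@signed_perm_inj n (fun i => odd (m i)))).
apply: eq_card => s; rewrite inE; apply/andP/imsetP.
  move=> [/signed_permP[p sE] /compatibleP[par H]].
  have {}sE : s = signed_perm (fun i => odd (m i)) p.
    rewrite sE; apply/permP => x; rewrite -[x]signed_sneg_sabs !signed_permE.
    by rewrite -par.
  exists p => //; rewrite inE; apply/forallP => i; apply/forallP => j.
  apply/implyP => /andP[/eqP ji /eqP mij].
  by have := H _ _ ji mij; rewrite sE !sval_at_signed_perm.
move=> [p]; rewrite inE => /forallP inc ->; split.
  apply/signed_permP; exists p; apply/permP => x.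
  rewrite -[x]signed_sneg_sabs !signed_permE.
  by rewrite spos_signed signed_permE sneg_signed.
apply/compatibleP; split=> [i|i j ji mij].
  by rewrite sval_at_signed_perm -/(sneg _) sneg_signed.
rewrite !sval_at_signed_perm; have /forallP/(_ j) := inc i.
by rewrite ji -!/(m _) mij !eqxx.
Qed.

End Counting.

(** * Comparison of coefficients *)

Lemma partition_sum_coef (n : nat) (m : 'X_{1..n}) :
  mps_fsum (partitions n) (fun lam : n.-tuple nat =>
    (multinomial n (mults lam))%:R * \prod_(i < n) q i ^+ tnth lam i) m =
  if sorted geq (multinom_val m) then (multinomial n (mults (multinom_val m)))%:R
  else 0.
Proof.
have coefE (lam : n.-tuple nat) :
    ((multinomial n (mults lam))%:R * \prod_(i < n) q i ^+ tnth lam i) m =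
    if m == Multinom lam then (multinomial n (mults lam))%:R else 0.
  have := mpsXX int (Multinom lam) m; rewrite mps_natM => ->.
  by case: eqP; rewrite ?mulr1 ?mulr0.
transitivity (\sum_(lam \in partitions n)
    if m == Multinom lam then (multinomial n (mults lam))%:R else 0 : int).
  by apply: eq_fsbigr => lam _; apply: coefE.
case: ifPn => sm.
  rewrite -(fsbig_widen [set multinom_val m]%classic) ?fsbig_set1.
  - by case: m sm {coefE} => t st; rewrite eqxx.
  - by move=> lam ->.
  - by move=> lam [_ /= lm]; case: eqP => // mE; case: lm; rewrite mE.
rewrite fsbig1 // => lam slam; case: eqP => // mE.
by move: slam; rewrite /partitions /=; move: sm; rewrite mE /= => /negPf ->.
Qed.

Theorem theorem6p5 (n : nat) (hn : (0 < n)%N) :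
  mps_fsum (partitions n) (fun lam : n.-tuple nat =>
    (multinomial n (mults lam))%:R * \prod_(i < n) q i ^+ tnth lam i) =
  (\sum_(s in B n) \prod_(i < n) q i ^+ (2 * d_stat s i + eps_stat s i)) /
  \prod_(i < n) (1 - \prod_(j < n | (j <= i)%N) q j ^+ 2).
Proof.
set D := \prod_(i < n) _.
have -> : D^-1 = even_partition_series n.
  rewrite -[RHS]mulr1 -(divrr (denominator_unit n)) mulrA.
  by rewrite even_partition_series_denominator mul1r.
apply: mpsP => m; rewrite partition_sum_coef mulr_suml mps_sumE.
(* Each [s] contributes 0 or 1 to the coefficient at [m]. *)
transitivity (\sum_(s in B n)
    (sorted geq (multinom_val m) && compatible m s)%:R : int).
  case: ifP => sm; last by rewrite big1.
  rewrite -card_compatible // -sum1_card natr_sum.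
  rewrite [RHS]big_mkcond [LHS]big_mkcond; apply: eq_bigr => s _.
  by rewrite inE; case: (s \in B n); case: compatible.
apply: eq_bigr => s _; rewrite -weight_even_partition.
have -> : \prod_(i < n) q i ^+ (2 * d_stat s i + eps_stat s i) =
          \prod_(i < n) mpsX int i ^+ weight s i.
  by apply: eq_bigr => i _; rewrite mnmE.
by rewrite mps_monomM; case: ifP.
Qed.
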